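(* Let $\Gamma$ be a countable discrete group. For every amenable URS $\mathcal{U}$ of $\Gamma$, there is a minimal compact $\Gamma$-space $X$ such that $\mathcal{S}_X=\mathcal{U}$.
   Context: A compact $\Gamma$-space is a (nonempty) compact Hausdorff space with an action of $\Gamma$ by homeomorphisms; it is minimal if it has no closed $\Gamma$-invariant subsets other than $\emptyset$ and itself. $\Gamma_x=\{t\in\Gamma: tx=x\}$, and $\Gamma_x^\circ$ is the subgroup of elements of $\Gamma$ that act as the identity on a neighborhood of $x$. $\mathrm{Sub}(\Gamma)$ is the set of all subgroups of $\Gamma$ with the Chabauty topology (relative topology of the product topology on $\{0,1\}^\Gamma$); $\Gamma$ acts on it by conjugation. A uniformly recurrent subgroup (URS) of $\Gamma$ is a minimal (nonempty) closed $\Gamma$-invariant subset of $\mathrm{Sub}(\Gamma)$; it is amenable if every subgroup belonging to it is amenable. The stability system $\mathcal{S}_X$ is the closure in $\mathrm{Sub}(\Gamma)$ of $\{\Gamma_x: x\in X,\ \Gamma_x=\Gamma_x^\circ\}$. *)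

(* Defs.v *)
From HB Require Import structures.
From mathcomp Require Import all_boot all_order ssralg ssrnum monoid.
From mathcomp Require Import all_classical all_reals topology.

Set Implicit Arguments.
Unset Strict Implicit.
Unset Printing Implicit Defensive.

Local Open Scope classical_set_scope.

Section GroupActions.
Variable G : groupType.

Record action_of (X : Type) := ActionOf {
  act_fun :> G -> X -> X;
  act_fun1 : forall x, act_fun 1%g x = x;
  act_funM : forall s t x, act_fun (s * t)%g x = act_fun s (act_fun t x) }.

Definition invariant_set (X : Type) (a : action_of X) (A : set X) : Prop :=
  forall t x, A x -> A (a t x).

Definition minimal_closed_invariant (X : topologicalType) (a : action_of X)
    (A : set X) : Prop :=
  [/\ A !=set0, closed A, invariant_set a A &
      forall B : set X, closed B -> invariant_set a B -> B `<=` A ->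
        B = set0 \/ B = A].

(* Since the maps [gs_act t] and [gs_act t^-1] are mutually inverse, their
   continuity makes the action one by homeomorphisms. *)
Record compact_gspace := CompactGSpace {
  gs_carrier :> topologicalType;
  gs_neq0 : [set: gs_carrier] !=set0;
  gs_compact : compact [set: gs_carrier];
  gs_hausdorff : hausdorff_space gs_carrier;
  gs_act : action_of gs_carrier;
  gs_continuous : forall t, continuous (gs_act t) }.

Definition minimal_gspace (X : compact_gspace) : Prop :=
  forall B : set X, closed B -> invariant_set (gs_act X) B ->
    B = set0 \/ B = setT.

(* Subgroups are encoded by their characteristic functions G -> bool;
   [subgroup_space] is Sub(G) with the Chabauty topology: the relative topology
   of the product topology on {0,1}^G. *)
Definition subgroup_set : set {ptws G -> bool} :=
  [set H | group_closed (H : {pred G})].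

Definition subgroup_space : topologicalType := set_type subgroup_set.

Definition sub_pred (H : subgroup_space) : {pred G} := (set_val H : G -> bool).

Definition mk_subgroup (P : {pred G}) (gP : group_closed P) : subgroup_space :=
  @SigSub _ _ subgroup_set (P : {ptws G -> bool}) (mem_set gP).

Lemma sub_predP (H : subgroup_space) : group_closed (sub_pred H).
Proof. exact: set_valP. Qed.

Lemma sub_inj (H K : subgroup_space) : sub_pred H =1 sub_pred K -> H = K.
Proof. by move=> HK; apply: val_inj; apply: funext. Qed.

(* x \in t H t^-1 iff x ^ t = t^-1 x t \in H. *)
Lemma conj_group_closed (H : subgroup_space) (t : G) :
  group_closed [pred x | (x ^ t)%g \in sub_pred H].
Proof.
have [H1 HD] := sub_predP H; split; first by rewrite inE conj1g.
by move=> x y; rewrite !inE conjMg conjVg => Hx Hy; apply: HD.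
Qed.

Definition conj_sub (t : G) (H : subgroup_space) : subgroup_space :=
  mk_subgroup (conj_group_closed H t).

Lemma conj_sub1 H : conj_sub 1%g H = H.
Proof. by apply: sub_inj => x; rewrite /sub_pred !set_valE /= conjg1. Qed.

Lemma conj_subM s t H : conj_sub (s * t)%g H = conj_sub s (conj_sub t H).
Proof. by apply: sub_inj => x; rewrite /sub_pred !set_valE /= conjgM. Qed.

Definition conj_action : action_of subgroup_space := ActionOf conj_sub1 conj_subM.

Definition URS (U : set subgroup_space) : Prop :=
  minimal_closed_invariant conj_action U.

Section Stabilizers.
Variables (X : compact_gspace) (x : X).
Let a := gs_act X.

Lemma stab_group_closed : group_closed [pred t : G | `[< a t x = x >]].
Proof.
split; first by apply/asboolP; rewrite act_fun1.
move=> s t /asboolP sx /asboolP tx; apply/asboolP.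
by rewrite -{1}tx -act_funM mulgVK.
Qed.

Definition stab : subgroup_space := mk_subgroup stab_group_closed.

Lemma germ_stab_group_closed :
  group_closed [pred t : G | `[< \forall y \near x, a t y = y >]].
Proof.
split; first by apply/asboolP; apply: nearW => y; rewrite act_fun1.
move=> s t /asboolP sx /asboolP tx; apply/asboolP.
by apply: filterS2 sx tx => y sy ty; rewrite -{1}ty -act_funM mulgVK.
Qed.

Definition germ_stab : subgroup_space := mk_subgroup germ_stab_group_closed.

End Stabilizers.

Definition stability_system (X : compact_gspace) : set subgroup_space :=
  closure [set stab x | x in [set x : X | stab x = germ_stab x]].

(* A finitely additive left-invariant probability measure on all subsets
   of the discrete group H; values of m off the subsets of H are irrelevant. *)
Definition amenable (R : realType) (H : subgroup_space) : Prop :=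
  let S := [set` sub_pred H] in
  exists m : set G -> R,
    [/\ m S = 1%R,
        forall A, A `<=` S -> (0 <= m A)%R,
        forall A B, A `<=` S -> B `<=` S -> A `&` B = set0 ->
          m (A `|` B) = (m A + m B)%R &
        forall h A, S h -> A `<=` S -> m [set (h * x)%g | x in A] = m A].

Definition amenable_family (R : realType) (U : set subgroup_space) : Prop :=
  forall H, U H -> amenable R H.

End GroupActions.

(* Main.v *)
Require Import Defs.
From HB Require Import structures.
From mathcomp Require Import all_boot all_order ssralg ssrnum monoid.
From mathcomp Require Import all_classical all_reals topology.

(** Fix a subgroup H in the URS U. A compact G-space Y in which the stabilizer
of each point depends continuously on the point, and which has a point with
stabilizer H, is enough. Indeed the points of Y whose stabilizer lies in U form
a nonempty closed invariant set, hence contain a minimal closed invariant set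
X. In X stabilizers still vary continuously, so every t fixing x fixes a
neighborhood of x, and the stability system of X is the whole image of the
stabilizer map. That image is closed, invariant and contained in U, so it is U
by minimality of U ([realize_URS_from_stab]).

To find Y, start from a G-set Z without topology that has a point with
stabilizer H: the powerset of G under left translation, with the point H. For
each g in G, a subset A_g of Z that is maximal among those disjoint from their
image under g has the property that every z moved by g has one of z, g z,
g^-1 z in A_g ([exists_separating_set]). Record the orbit of z as the 0-1 array
(g, t) |-> [t z in A_g]. Reading the entries (g, 1), (g, g), (g, g^-1) of the
array tells whether g fixes z, and this criterion is expressed by closed
conditions on arrays. The arrays that satisfy them and all their shifts form a
compact G-space whose stabilizers are locally determined by finitely many
entries ([exists_compactification]). It plays the role of the Stone-Cech
compactification of Z, in which the fixed-point set of a bijection of Z extended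
to the compactification is the closure of its fixed-point set in Z. *)

Local Open Scope classical_set_scope.

Set Implicit Arguments.
Unset Strict Implicit.
Unset Printing Implicit Defensive.

(** * Spaces of 0-1 valued functions, and subspaces *)

Lemma near_coord (T : choiceType) (y : {ptws T -> bool}) (p : T) :
  \forall z \near y, z p = y p.
Proof.
exact: (@proj_continuous T (fun=> bool) p y _ (discrete_set1 (y p))).
Qed.

Lemma continuous_ptws_bool (X : topologicalType) (T : Type)
    (f : X -> {ptws T -> bool}) :
  (forall x p, \forall y \near x, f y p = f x p) -> continuous f.
Proof.
move=> flc x; apply/cvg_sup => p A [_ [[C oC <-] Cx CA]].
by apply: filterS (flc x p) => y /= yx; apply: CA; rewrite /= yx.
Qed.

Lemma hausdorff_ptws_bool (T : choiceType) : hausdorff_space {ptws T -> bool}.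
Proof.
exact: (@hausdorff_product T (fun=> bool) (fun=> @discrete_hausdorff bool)).
Qed.

Lemma compact_ptws_bool (T : choiceType) : compact [set: {ptws T -> bool}].
Proof.
rewrite (_ : setT = [set f : T -> bool | forall p, [set: bool] (f p)]).
  exact: (@tychonoff T (fun=> bool) (fun=> setT) (fun=> bool_compact)).
by apply/seteqP; split.
Qed.

Lemma val_continuous (X : topologicalType) (A : set X) :
  continuous (val : set_type A -> X).
Proof. exact: (@initial_continuous (set_type A) X val). Qed.

Lemma hausdorff_set_type (X : topologicalType) (A : set X) :
  hausdorff_space X -> hausdorff_space (set_type A).
Proof.
move=> hX p q pq; apply: val_inj; apply: (hX (val p) (val q)) => B C Bp Cq.
have [r [Br Cr]] := pq _ _ (val_continuous Bp) (val_continuous Cq).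
by exists (val r).
Qed.

Lemma compact_set_type (X : topologicalType) (A : set X) :
  compact A -> compact [set: set_type A].
Proof.
move=> cA F PF _.
have [p [Ap clp]] : A `&` cluster (val @ F) !=set0.
  apply: cA; rewrite nbhs_simpl /=.
  by apply: (@filterS _ F _ setT); [move=> x _; exact: set_valP|exact: filterT].
exists (@SigSub _ _ A p (mem_set Ap)); split=> // B C FB [_ [[D oD <-] Dp DC]].
have [||_ [[x Bx <-] Dx]] := clp (set_val @` B) D.
- by apply: (@filterS _ F _ B) FB => x Bx; exists x.
- exact: open_nbhs_nbhs.
by exists x; split=> //; exact: DC.
Qed.

(** * Minimal sets and invariant subspaces *)

Section Spaces.
Variable G : groupType.
Implicit Type X : compact_gspace G.

Lemma actK (T : Type) (a : action_of G T) t : cancel (a t) (a t^-1%g).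
Proof. by move=> x; rewrite -act_funM mulVg act_fun1. Qed.

Lemma actVK (T : Type) (a : action_of G T) t : cancel (a t^-1%g) (a t).
Proof. by move=> x; rewrite -act_funM mulgV act_fun1. Qed.

(** Zorn's lemma is applied to the open sets that are complements of the
candidates. A chain of them cannot cover [E]: the traces on [E] of their
complements generate a proper filter, and this filter has a cluster point in
the compact set [E]. *)
Lemma exists_minimal X (E : set X) :
  E !=set0 -> closed E -> invariant_set (gs_act X) E ->
  exists2 M, M `<=` E & minimal_closed_invariant (gs_act X) M.
Proof.
move=> E0 cE iE; set a := gs_act X in iE *.
have [|O [[oO iO EO] maxO]] := @Zorn_bigcup X
    [set O | [/\ open O, invariant_set a (~` O) & E `&` ~` O !=set0]].
  move=> F FP totF; split.
  - by apply: bigcup_open => O /FP [].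
  - move=> t x nFx [O FO Otx]; have [_ iO _] := FP _ FO.
    by apply: (iO t x _ Otx) => Ox; apply: nFx; exists O.
  (* The empty chain generates no proper filter, so it is treated apart. *)
  have [->|/set0P [O0 FO0]] := eqVneq F set0.
    by rewrite bigcup_set0 setC0 setIT.
  pose B (O : set X) := E `&` ~` O.
  have FB : ProperFilter (filter_from F B).
    apply: filter_from_proper; last by move=> O /FP [].
    apply: filter_from_filter; first by exists O0.
    move=> O O' FO FO'; have [OO'|O'O] := totF _ _ FO FO'.
      by exists O' => // x [Ex nx]; do !split => //; move=> /OO'.
    by exists O => // x [Ex nx]; do !split => //; move=> /O'O.
  have cpE : compact E by exact: subclosed_compact cE (@gs_compact _ X) _.
  have [|p [Ep clp]] := cpE _ FB; first by exists O0 => // x [].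
  exists p; split=> // -[O FO Op]; have [oO _ _] := FP _ FO.
  have [||x [[_ nOx] Ox]] := clp (B O) O; [by exists O| |by []].
  exact: open_nbhs_nbhs.
exists (E `&` ~` O); first exact: subIsetl.
split=> //; first by apply: closedI => //; exact: open_closedC.
  by move=> t x [Ex Ox]; split; [exact: iE|exact: iO].
move=> B cB iB BEO.
have [->|/set0P B0] := eqVneq B set0; [by left|right].
apply/seteqP; split=> // x [Ex nOx]; apply: contrapT => nBx.
apply: (maxO (~` B)).
  split; first by move=> z Oz /BEO [].
  by move=> /(_ x nBx).
split; [exact: closed_openC|by rewrite setCK|rewrite setCK].
by have [b Bb] := B0; exists b; split=> //; have [] := BEO _ Bb.
Qed.

Section Subspace.
Variables (X : compact_gspace G) (E : set X).
Hypotheses (E0 : E !=set0) (cE : closed E) (iE : invariant_set (gs_act X) E).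

Let act t (x : set_type E) : set_type E :=
  @SigSub _ _ E (gs_act X t (val x)) (mem_set (iE t (set_valP x))).

Lemma sub_act1 x : act 1%g x = x.
Proof. by apply: val_inj; rewrite /= act_fun1. Qed.

Lemma sub_actM s t x : act (s * t)%g x = act s (act t x).
Proof. by apply: val_inj; rewrite /= act_funM. Qed.

Lemma sub_act_continuous t : continuous (act t).
Proof.
apply: (@continuous_comp_initial _ _ _ set_val) => x.
exact: continuous_comp (@val_continuous _ E x) (@gs_continuous _ X t (val x)).
Qed.

Lemma sub_neq0 : [set: set_type E] !=set0.
Proof. by have [x Ex] := E0; exists (@SigSub _ _ E x (mem_set Ex)). Qed.

Lemma sub_compact : compact [set: set_type E].
Proof.
exact/compact_set_type/(subclosed_compact cE (@gs_compact _ X)).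
Qed.

Definition sub_gspace : compact_gspace G :=
  CompactGSpace sub_neq0 sub_compact
    (hausdorff_set_type (@gs_hausdorff _ X))
    (gs_act := ActionOf sub_act1 sub_actM) sub_act_continuous.
End Subspace.

(** * Compact spaces with continuous stabilizer map *)

Lemma sub_pred_stab X (x : X) t :
  sub_pred (stab x) t = `[< gs_act X t x = x >].
Proof. by rewrite /sub_pred set_valE. Qed.

Lemma stab_act X (x : X) t : stab (gs_act X t x) = conj_sub t (stab x).
Proof.
apply: sub_inj => s; rewrite sub_pred_stab /sub_pred set_valE /=.
rewrite -[RHS]/(sub_pred (stab x) (s ^ t)%g) sub_pred_stab conjgE !act_funM.
by apply: asbool_equiv_eq; split=> [->|{2}<-]; rewrite ?actK ?actVK.
Qed.

Lemma near_sub_pred (H : subgroup_space G) t :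
  \forall K \near H, sub_pred K t = sub_pred H t.
Proof. exact: (val_continuous (near_coord (set_val H) t)). Qed.

Lemma hausdorff_subgroup_space : hausdorff_space (subgroup_space G).
Proof. exact/hausdorff_set_type/hausdorff_ptws_bool. Qed.

Lemma stab_continuousP X :
  (forall x t, \forall y \near x,
     (gs_act X t y = y) <-> (gs_act X t x = x)) ->
  continuous (@stab G X).
Proof.
move=> locX; apply: (@continuous_comp_initial _ _ _ set_val).
apply: continuous_ptws_bool => x t; apply: filterS (locX x t) => y yx.
by rewrite /= !set_valE /=; apply: asbool_equiv_eq.
Qed.

(** Continuity of the stabilizer map at [x] says that fixing a point is, for
each group element, a locally constant condition near [x]. *)
Lemma stab_germ_stab X (x : X) :
  continuous (@stab G X) -> stab x = germ_stab x.
Proof.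
move=> cX; apply: sub_inj => t.
rewrite /sub_pred !set_valE /=; apply: asbool_equiv_eq; split; last first.
  exact: nbhs_singleton.
move=> tx; have := cX x _ (near_sub_pred (stab x) t).
apply: (@filterS _ (nbhs x)) => y; rewrite /= !sub_pred_stab => yx.
by apply/asboolP; rewrite yx; apply/asboolP.
Qed.

(** All points of [X] contribute to the stability system, which is therefore
the image of the stabilizer map; compactness makes this image closed before any
closure is taken, and the minimality of [U] does the rest. *)
Lemma stability_system_eq X (U : set (subgroup_space G)) :
  URS U -> continuous (@stab G X) -> (forall x : X, U (stab x)) ->
  stability_system X = U.
Proof.
move=> [_ _ _ minU] cX XU.
have allX : [set x : X | stab x = germ_stab x] = setT.
  by apply/seteqP; split=> // x _; exact: stab_germ_stab.
have cS : closed (range (@stab G X)).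
  apply: compact_closed; first exact: hausdorff_subgroup_space.
  by apply: continuous_compact (@gs_compact _ X); exact: continuous_subspaceT.
rewrite /stability_system allX -(proj1 (closure_id _) cS).
have [x0 _] := gs_neq0 X.
have [||S0|//] := minU _ cS.
- by move=> t _ [x _ <-]; exists (gs_act X t x) => //; exact: stab_act.
- by move=> _ [x _ <-].
- by have : range (@stab G X) (stab x0) by []; rewrite S0.
Qed.

(** * Minimal subsystems with prescribed stabilizers *)

Lemma sub_stab X (E : set X) E0 cE iE (x : @sub_gspace X E E0 cE iE) :
  stab x = stab (val x : X).
Proof.
apply: sub_inj => t; rewrite /sub_pred !set_valE /=.
by apply: asbool_equiv_eq; split=> [/(congr1 val)|tx //]; last exact: val_inj.
Qed.

(** A closed invariant subset of the subspace is compact, so it is also closed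
in the ambient space, where minimality of [E] applies. *)
Lemma sub_minimal X (E : set X) E0 cE iE :
  minimal_closed_invariant (gs_act X) E ->
  minimal_gspace (@sub_gspace X E E0 cE iE).
Proof.
move=> [_ _ _ minE] B cB iB.
have cvB : closed (set_val @` B : set X).
  apply: compact_closed; first exact: gs_hausdorff.
  apply: continuous_compact.
    by apply: continuous_subspaceT; exact: val_continuous.
  exact: subclosed_compact cB (@gs_compact _ (sub_gspace E0 cE iE)) _.
have [||B0|BE] := minE _ cvB.
- by move=> t _ [x Bx <-]; exists (gs_act (sub_gspace E0 cE iE) t x) => //;
    exact: iB.
- by move=> _ [x _ <-]; exact: set_valP.
- left; apply/seteqP; split=> // x Bx.
  have : (set_val @` B : set X) (val x) by exists x.
  by rewrite B0.
right; apply/seteqP; split=> // x _.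
have : (set_val @` B : set X) (val x) by rewrite BE; exact: set_valP.
by move=> [y By /val_inj <-].
Qed.

(** The points with stabilizer in [U] form a closed invariant set because the
stabilizer map is continuous and equivariant, so [X] may be replaced by a
minimal set inside it. *)
Lemma realize_URS_from_stab X (U : set (subgroup_space G)) (x0 : X) :
  URS U -> continuous (@stab G X) -> U (stab x0) ->
  exists Y : compact_gspace G, minimal_gspace Y /\ stability_system Y = U.
Proof.
move=> UU cX Ux0; have [_ cU iU _] := UU.
have [|||M MU minM] := @exists_minimal X (@stab G X @^-1` U).
- by exists x0.
- by apply: preimage_closed => // x _; exact: cX.
- by move=> t x Ux; rewrite /= stab_act; exact: iU.
have [M0 cM iM _] := minM.
exists (sub_gspace M0 cM iM); split; first exact: sub_minimal.
apply: stability_system_eq => //.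
  have -> : @stab G (sub_gspace M0 cM iM) = @stab G X \o set_val.
    by apply/funext => x; exact: sub_stab.
  move=> x; exact: continuous_comp (@val_continuous _ M x) (cX (val x)).
by move=> x; rewrite sub_stab; apply: MU; exact: set_valP.
Qed.

(** * A compactification of a discrete action preserving stabilizers *)

(** Take [A] maximal among the sets disjoint from their image under [f]. If [f]
moves [z] and none of [z], [f z], [g z] is in [A], then adding [z] to [A] keeps
the disjointness. *)
Lemma exists_separating_set (Z : Type) (f g : Z -> Z) :
  cancel f g ->
  exists A : set Z, (forall z, A z -> ~ A (f z)) /\
    (forall z, ~ A z -> ~ A (f z) -> ~ A (g z) -> f z = z).
Proof.
move=> fK.
have [|A [fA maxA]] := @Zorn_bigcup Z [set A | forall z, A z -> ~ A (f z)].
  move=> F FP totF z [A FA Az] [B FB Bfz].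
  have [AB|BA] := totF _ _ FA FB.
    by apply: FP FB z (AB _ Az) Bfz.
  by apply: FP FA z Az (BA _ Bfz).
exists A; split=> // z nAz nAfz nAgz; apply: contrapT => fz.
apply: (maxA (A `|` [set z])).
  by split=> [y|]; [left|move=> /(_ z (or_intror erefl))].
move=> y [Ay|->] [Afy|].
- exact: fA Ay Afy.
- by move=> fyz; apply: nAgz; rewrite -fyz fK.
- by [].
- exact: fz.
Qed.

Section Markers.

(* The entry at (g, t) of the array coding z is meant to be [t z in A_g]; the
   coordinate t is shifted on the right because s z has entry [t s z in A_g]. *)
Let coding := {ptws (G * G)%type -> bool}.

Let shift (s : G) (y : coding) : coding := fun p => y (p.1, p.2 * s)%g.

Lemma shift1 y : shift 1%g y = y.
Proof. by apply/funext => -[g t]; rewrite /shift mulg1. Qed.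

Lemma shiftM s t y : shift (s * t)%g y = shift s (shift t y).
Proof. by apply/funext => -[g r]; rewrite /shift /= mulgA. Qed.

Lemma shift_continuous s : continuous (shift s).
Proof. by apply: continuous_ptws_bool => y p; exact: near_coord. Qed.

Definition shift_gspace : compact_gspace G :=
  CompactGSpace (ex_intro _ (fun=> false) I : [set: coding] !=set0)
    (@compact_ptws_bool _) (@hausdorff_ptws_bool _)
    (gs_act := ActionOf shift1 shiftM) shift_continuous.

(** For the array coding z: none of z, s z, s^-1 z belongs to A_s, which by the
choice of A_s happens exactly when s fixes z. *)
Definition unmarked (y : coding) (s : G) : Prop :=
  [/\ ~~ y (s, 1%g), ~~ y (s, s) & ~~ y (s, s^-1)%g].

(** The first condition keeps, in the limit, the disjointness of A_g and its
image under g; the second one keeps the fact that z is fixed by g as soon as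
none of z, g z, g^-1 z is in A_g. Both are required of all shifts of the array,
which makes the set invariant. *)
Definition marker_space : set shift_gspace :=
  [set y | forall t g, ~~ (shift t y (g, 1%g) && shift t y (g, g)) /\
     (unmarked (shift t y) g -> shift g (shift t y) = shift t y)].

Lemma near_unmarked y s :
  \forall z \near y, unmarked z s <-> unmarked y s.
Proof.
apply: filterS3 (near_coord y (s, 1%g)) (near_coord y (s, s))
  (near_coord y (s, s^-1)%g) => z.
by rewrite /unmarked => -> -> ->.
Qed.

(** If [s] fixes [y], the three entries of [y] read by [unmarked] are equal, and
they cannot all be true because the entries at (s, 1) and (s, s) are not. *)
Lemma marker_space_fixP y s :
  marker_space y -> (shift s y = y <-> unmarked y s).
Proof.
move=> /(_ 1%g s); rewrite shift1 => -[indep sK]; split=> [ys|/sK //].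
have e t : y (s, t * s)%g = y (s, t) by rewrite -{2}ys.
have := e 1%g; have := e s^-1%g; rewrite mul1g mulVg => e1 e2.
by move: indep; rewrite /unmarked -e1 e2 andbb.
Qed.

(** A violated condition is witnessed by finitely many entries of the array, and
these are locally constant: for the second condition, the three entries read by
[unmarked] and the two entries that differ between the array and its shift. *)
Lemma closed_marker_space : closed marker_space.
Proof.
rewrite -[marker_space]setCK; apply: open_closedC; rewrite openE => y /=.
move=> /existsNP [t /existsNP [g nQ]].
have cont p : \forall z \near y, shift t z p = shift t y p.
  exact: near_coord.
have [both|nboth] := boolP (shift t y (g, 1%g) && shift t y (g, g)).
  apply: filterS2 (cont (g, 1%g)) (cont (g, g)) => z z1 zg /(_ t g) [+ _].
  by rewrite z1 zg both.
have [um /existsNP[p yp]] : unmarked (shift t y) g /\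
    ~ forall p, shift g (shift t y) p = shift t y p.
  split; first by apply: contrapT => num; apply: nQ.
  by move=> /funext e; apply: nQ.
have umz : \forall z \near y, unmarked (shift t z) g.
  have := shift_continuous (near_unmarked (shift t y) g).
  by apply: (@filterS _ (nbhs y)) => z /= ->.
have cont' : \forall z \near y,
    shift g (shift t z) p = shift g (shift t y) p.
  exact: near_coord.
apply: filterS3 umz cont' (cont p) => z um' zp zp' /(_ t g) [_ /(_ um') e].
by apply: yp; rewrite -zp -zp' e.
Qed.

Lemma invariant_marker_space : invariant_set (gs_act shift_gspace) marker_space.
Proof. by move=> s y My t g; rewrite /= -shiftM; exact: My. Qed.

(** The orbit of [z0] is coded by a family of separating sets, one for each
group element. Fixing an array of the marker space is a condition on three
entries, hence locally constant, and on the array coding [z0] it amounts to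
fixing [z0]. *)
Lemma exists_compactification (Z : Type) (a : action_of G Z) (z0 : Z) :
  exists (Y : compact_gspace G) (y0 : Y), continuous (@stab G Y) /\
    forall t, sub_pred (stab y0) t <-> a t z0 = z0.
Proof.
have /choice[A AP] : forall g, exists A : set Z,
    (forall z, A z -> ~ A (a g z)) /\
    (forall z, ~ A z -> ~ A (a g z) -> ~ A (a g^-1%g z) -> a g z = z).
  by move=> g; exact/exists_separating_set/actK.
pose code (z : Z) : coding := fun p => `[< A p.1 (a p.2 z) >].
have codeE s z : shift s (code z) = code (a s z).
  by apply/funext => -[g t]; rewrite /shift /code /= act_funM.
have unmarkedE s z : unmarked (code z) s -> a s z = z.
  rewrite /unmarked /code /= act_fun1.
  by move=> [/asboolPn ? /asboolPn ? /asboolPn ?]; apply: (AP s).2.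
have Mcode z : marker_space (code z).
  move=> t g; rewrite !codeE; move: (a t z) => {z t} z.
  split; last by move=> /unmarkedE ->.
  rewrite /code /= act_fun1; apply/andP => -[/asboolP Az /asboolP].
  exact: (AP g).1.
have M0 : marker_space !=set0 by exists (code z0).
pose Y := sub_gspace M0 closed_marker_space invariant_marker_space.
exists Y, (@SigSub _ _ marker_space (code z0) (mem_set (Mcode z0))); split.
  have fixE (y : Y) s : gs_act Y s y = y <-> unmarked (set_val y) s.
    rewrite -(marker_space_fixP s (set_valP y)).
    by split=> [/(congr1 val)|ys //]; last exact: val_inj.
  apply: stab_continuousP => y s.
  have := val_continuous (near_unmarked (set_val y) s).
  by apply: (@filterS _ (nbhs y)) => z /=; rewrite !fixE.
move=> t; rewrite sub_stab sub_pred_stab /=; split=> [/asboolP|tz].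
  by move=> /(marker_space_fixP _ (Mcode z0)) /unmarkedE.
by apply/asboolP; rewrite codeE tz.
Qed.

End Markers.

(** * Realizing a subgroup as a stabilizer *)

(* The coset space of a subgroup H is an orbit of this action, that of H itself;
   working in the whole powerset avoids forming the quotient. *)
Let translate (t : G) (A : set G) : set G := [set x | A (t^-1 * x)%g].

Lemma translate1 A : translate 1%g A = A.
Proof. by apply/funext => x; rewrite /translate /= invg1 mul1g. Qed.

Lemma translateM s t A : translate (s * t)%g A = translate s (translate t A).
Proof. by apply/funext => x; rewrite /translate /= invgM mulgA. Qed.

Lemma translate_subgroup (H : subgroup_space G) t :
  translate t [set` sub_pred H] = [set` sub_pred H] <-> sub_pred H t.
Proof.
have gH := sub_predP H; have [H1 _] := gH.
have HV := group_closedV gH; have HM := group_closedM gH.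
split=> [e|Ht].
  have : translate t [set` sub_pred H] t by rewrite /translate /= mulVg.
  by rewrite e.
apply/seteqP; split=> x; rewrite /translate /= => Hx.
  by rewrite -(mulVKg t x); exact: HM.
by apply: HM => //; exact: HV.
Qed.

Lemma URS_is_stability_system (U : set (subgroup_space G)) :
  URS U ->
  exists Y : compact_gspace G, minimal_gspace Y /\ stability_system Y = U.
Proof.
move=> UU; have [[H UH] _ _ _] := UU.
have [Y [y0 [cY y0E]]] :=
  exists_compactification (ActionOf translate1 translateM) [set` sub_pred H].
apply: (@realize_URS_from_stab Y U y0) => //.
rewrite (_ : stab y0 = H) //; apply: sub_inj => t.
by apply/idP/idP => [/y0E|/translate_subgroup /y0E];
  rewrite ?translate_subgroup.
Qed.

End Spaces.

Theorem corollary7p6 (R : realType) (G : groupType)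
    (countG : countable [set: G]) (U : set (subgroup_space G)) :
  URS U -> amenable_family R U ->
  exists X : compact_gspace G, minimal_gspace X /\ stability_system X = U.
Proof. by move=> UU _; exact: URS_is_stability_system. Qed.
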